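(* Let ${\mathbf A},{\mathbf B}$ be real $n\times n$ matrices and let $$\widetilde{\mathbf A}=\begin{pmatrix}{\mathbf A}&{\mathbf B}\\ {\mathbf I}&{\mathbf O}\end{pmatrix}$$ be the corresponding $2n\times2n$ matrix. Let ${\mathbf B}$ be diagonalizable, i.e. there is an invertible matrix ${\mathbf S}$ such that ${\mathbf B}={\mathbf S}{\mathbf \Lambda}_{\mathbf B}{\mathbf S}^{-1}$, where ${\mathbf \Lambda}_{\mathbf B}={\rm diag}\{\nu_1,\ldots,\nu_n\}$ and $\nu_1,\ldots,\nu_n$ are the eigenvalues of ${\mathbf B}$. If $\nu_i<0$ for all $i=1,\ldots,n$ and the (real) matrix ${\mathbf S}^{-1}{\mathbf A}{\mathbf S}$ is diagonally stable, then $\widetilde{\mathbf A}$ is stable. In particular, if ${\mathbf B}$ is negative diagonal and ${\mathbf A}$ is diagonally stable, then $\widetilde{\mathbf A}$ is stable.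
   Context: ${\mathbf I}$, ${\mathbf O}$ are the $n\times n$ identity and zero matrices. A matrix is stable if all its eigenvalues have negative real parts. A real $n\times n$ matrix ${\mathbf A}$ is diagonally stable if ${\mathbf D}{\mathbf A}+{\mathbf A}^T{\mathbf D}$ is negative definite for some diagonal matrix ${\mathbf D}$ with positive diagonal entries. Negative diagonal means diagonal with all diagonal entries negative. *)

(* Defs.v *)
From mathcomp Require Export all_boot all_order all_algebra.
From mathcomp Require Export reals.
From mathcomp Require Export complex.

Set Implicit Arguments.
Unset Strict Implicit.
Unset Printing Implicit Defensive.

Import Order.TTheory GRing.Theory Num.Theory.

Local Open Scope ring_scope.

Notation complexmx A := (map_mx (real_complex _) A).

(* The eigenvalues of a real matrix are those of its complexification.
   MathComp's [eigenvalue] uses row eigenvectors; a square matrix and its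
   transpose have the same eigenvalues. *)
Definition stable_mx (R : realType) (m : nat) (A : 'M[R]_m) : Prop :=
  forall z : R[i], eigenvalue (complexmx A) z -> complex.Re z < 0.

Definition neg_definite (R : realType) (n : nat) (Q : 'M[R]_n) : Prop :=
  Q^T = Q /\ forall x : 'cV[R]_n, x != 0 -> (x^T *m Q *m x) 0 0 < 0.

Definition diagonally_stable (R : realType) (n : nat) (A : 'M[R]_n) : Prop :=
  exists d : 'rV[R]_n,
    (forall i, 0 < d 0 i) /\
    neg_definite (diag_mx d *m A + A^T *m diag_mx d).

Definition negative_diagonal (R : realType) (n : nat) (B : 'M[R]_n) : Prop :=
  is_diag_mx B /\ forall i, B i i < 0.

Definition companion2 (R : realType) (n : nat) (A B : 'M[R]_n) :
    'M[R]_(n + n) :=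
  block_mx A B 1%:M 0.

(* Main.v *)
Require Import Defs.
From mathcomp Require Import ring lra.

(** An eigenvector of the companion matrix for [z] is determined by half of
    its entries, a nonzero row [u] with [z^2 u = z u A + u B]; this relation is
    the quadratic eigenvalue problem hidden in the block matrix
    ([companion_eigenvalue_pencil]).  Conjugating by [S] turns it into
    [z^2 v = z v M + v N], where [M = S^-1 A S] is diagonally stable and
    [N = S^-1 B S] is diagonal with negative entries ([pencil_similar]).

    Let [D] be the positive diagonal matrix witnessing the stability of [M].
    Write [v = y^T D] and multiply the relation on the right by the conjugate
    of [y].  With [H(K) = y^T K conj(y)], the vector equation becomes the scalar
    equation [z^2 H(D) = z H(D M) + H(D N)].  The choice of multiplier makes
    all three coefficients controllable.  As [D] and [D N] are real, diagonal
    and of constant sign, [H(D) > 0] and [H(D N) < 0] are real; as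
    [D M + M^T D] is negative definite, [Re H(D M) < 0].  A root [z] of such
    a quadratic equation lies in the open left half-plane
    ([quadratic_root_Re_lt0]): the real part of the equation multiplied by
    [conj z] is [Re z (|z|^2 h - k) = |z|^2 Re m], where [h = H(D)], [k = H(D N)]
    and [m = H(D M)]; the factor of [Re z] is positive and the right-hand side
    is negative as soon as [z] is nonzero, and [z = 0] would force [k = 0].

    The case of a negative diagonal [B] is the case [S = I]. *)

Set Implicit Arguments.
Unset Strict Implicit.
Unset Printing Implicit Defensive.

Import Order.TTheory GRing.Theory Num.Theory.

Local Open Scope ring_scope.

(** For a row [(u, w)], the two column blocks of the eigenvector equation read
    [u A + w = z u] and [u B = z w].  The first one expresses [w] in terms of
    [u], so [u] cannot vanish, and eliminating [w] gives the pencil. *)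
Lemma companion_eigenvalue_pencil (F : fieldType) (n : nat) (A B : 'M[F]_n)
    (z : F) :
  eigenvalue (block_mx A B 1%:M 0 : 'M_(n + n)) z ->
  exists2 u : 'rV[F]_n,
    u != 0 & z ^+ 2 *: u = z *: (u *m A) + u *m B.
Proof.
case/eigenvalueP=> v; rewrite -[v]hsubmxK.
move: (lsubmx v) (rsubmx v) => u w.
rewrite mul_row_block mulmx1 mulmx0 addr0 scale_row_mx => /eq_row_mx[uA uB] v0.
exists u.
  apply: contraNneq v0 => u0.
  by move: uA; rewrite u0 mul0mx add0r scaler0 => ->; rewrite row_mx0.
by rewrite uB -scalerDr uA scalerA expr2.
Qed.

Lemma pencil_similar (F : fieldType) (n : nat) (A B S : 'M[F]_n)
    (u : 'rV[F]_n) (z : F) :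
  S \in unitmx -> u != 0 -> z ^+ 2 *: u = z *: (u *m A) + u *m B ->
  exists2 v : 'rV[F]_n, v != 0 &
    z ^+ 2 *: v = z *: (v *m (invmx S *m A *m S)) + v *m (invmx S *m B *m S).
Proof.
move=> uS u0 eq_u; exists (u *m S).
  by apply: contraNneq u0 => uS0; rewrite -(mulmxK uS u) uS0 mul0mx.
rewrite !mulmxA !(mulmxK uS) !scalemxAl -mulmxDl.
by rewrite -[(z *: u) *m A]scalemxAl -eq_u.
Qed.

Lemma bilinear_tr (R : comNzRingType) (n : nat) (p q : 'cV[R]_n) (K : 'M[R]_n) :
  (p^T *m K^T *m q) 0 0 = (q^T *m K *m p) 0 0.
Proof.
have <- : (q^T *m K *m p)^T = p^T *m K^T *m q by rewrite !trmx_mul trmxK mulmxA.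
by rewrite mxE.
Qed.

(** The sesquilinear form of a real matrix [K] on complex vectors, with the
    conjugate on the right so that it arises from row-vector equations by
    right multiplication. *)
Definition hform (R : realType) (n : nat) (y : 'cV[R[i]]_n) (K : 'M[R]_n) :
    R[i] :=
  (y^T *m complexmx K *m map_mx (@conjc R) y) 0 0.

Definition realform (R : realType) (n : nat) (y : 'cV[R[i]]_n) (K : 'M[R]_n) :
    R :=
  let q (x : 'cV[R]_n) := (x^T *m K *m x) 0 0 in
  q (map_mx (@complex.Re R) y) + q (map_mx (@complex.Im R) y).

(** With [y = p + i q], expanding [(p + i q)^T K (p - i q)] leaves the two real
    quadratic values in the real part and the antisymmetric defect of [K] in
    the imaginary part. *)
Lemma hformE (R : realType) (n : nat) (y : 'cV[R[i]]_n) (K : 'M[R]_n) :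
  let p := map_mx (@complex.Re R) y in
  let q := map_mx (@complex.Im R) y in
  hform y K =
  Complex (realform y K) ((q^T *m K *m p) 0 0 - (p^T *m K *m q) 0 0).
Proof.
move=> p q.
have yE : y = complexmx p + 'i%C *: complexmx q.
  by apply/matrixP=> i j; rewrite !mxE; case: (y i j) => a b; simpc.
have ycE : map_mx (@conjc R) y = complexmx p - 'i%C *: complexmx q.
  by apply/matrixP=> i j; rewrite !mxE; case: (y i j) => a b; simpc.
have ytE : y^T = complexmx p^T + 'i%C *: complexmx q^T.
  by rewrite {1}yE [LHS]linearD /= linearZ /= !map_trmx.
rewrite /hform ycE ytE /realform -/p -/q !mulmxDl !mulmxBr -!scalemxAl -!scalemxAr.
rewrite -!map_mxM !mxE.
by simpc; congr Complex; ring.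
Qed.

Lemma hform_sym (R : realType) (n : nat) (y : 'cV[R[i]]_n) (K : 'M[R]_n) :
  K^T = K -> hform y K = (realform y K)%:C%C.
Proof.
move=> symK; rewrite hformE; congr Complex; apply/eqP; rewrite subr_eq0.
by rewrite -{1}symK bilinear_tr.
Qed.

(** One of the real and imaginary parts of a nonzero complex vector is
    nonzero, which transfers real definiteness to complex vectors. *)
Lemma realform_gt0 (R : realType) (n : nat) (y : 'cV[R[i]]_n) (K : 'M[R]_n) :
  (forall x : 'cV[R]_n, x != 0 -> 0 < (x^T *m K *m x) 0 0) ->
  y != 0 -> 0 < realform y K.
Proof.
move=> posK y0; rewrite /realform; set p := map_mx _ y; set q := map_mx _ y.
have nnK (x : 'cV[R]_n) : 0 <= (x^T *m K *m x) 0 0.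
  by have [->|/posK/ltW//] := eqVneq x 0; rewrite mulmx0 mxE.
have [p0|/posK p_gt0] := eqVneq p 0; last exact: ltr_pwDl.
apply: ltr_wpDl => //; apply: posK; apply: contraNneq y0 => q0.
apply/eqP/matrixP=> i j; apply/eqP; rewrite mxE eq_complex /=.
move/matrixP/(_ i j): p0; move/matrixP/(_ i j): q0.
by rewrite !mxE => -> ->; rewrite eqxx.
Qed.

Lemma realformN (R : realType) (n : nat) (y : 'cV[R[i]]_n) (K : 'M[R]_n) :
  realform y (- K) = - realform y K.
Proof. by rewrite /realform !mulmxN !mulNmx !mxE opprD. Qed.

Lemma realformD (R : realType) (n : nat) (y : 'cV[R[i]]_n) (K L : 'M[R]_n) :
  realform y (K + L) = realform y K + realform y L.
Proof. by rewrite /realform !mulmxDr !mulmxDl !mxE addrACA. Qed.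

Lemma realform_tr (R : realType) (n : nat) (y : 'cV[R[i]]_n) (K : 'M[R]_n) :
  realform y K^T = realform y K.
Proof. by rewrite /realform !bilinear_tr. Qed.

Lemma diag_form_gt0 (R : realType) (n : nat) (d : 'rV[R]_n) :
  (forall i, 0 < d 0 i) ->
  forall x : 'cV[R]_n, x != 0 -> 0 < (x^T *m diag_mx d *m x) 0 0.
Proof.
move=> d_gt0 x /cV0Pn[i xi0]; rewrite mul_mx_diag mxE.
have xE j : (\matrix_(i, j) (x^T i j * d 0 j)) 0 j * x j 0 = d 0 j * x j 0 ^+ 2.
  by rewrite !mxE; ring.
rewrite (eq_bigr _ (fun j _ => xE j)) (bigD1 i) //= ltr_pwDl //.
  by rewrite mulr_gt0 // exprn_even_gt0.
by apply: sumr_ge0 => j _; rewrite mulr_ge0 ?sqr_ge0 // ltW.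
Qed.

(** The equation is that of a damped oscillator with mass [h], stiffness [-k]
    and complex damping [-m]: damping with positive real part moves both roots
    off the closed right half-plane. *)
Lemma quadratic_root_Re_lt0 (R : realType) (z m : R[i]) (h k : R) :
  0 < h -> k < 0 -> complex.Re m < 0 ->
  z ^+ 2 * h%:C%C = z * m + k%:C%C -> complex.Re z < 0.
Proof.
case: z m => [a b] [s t] /= h_gt0 k_lt0 s_lt0; rewrite expr2; simpc.
case=> reE imE; rewrite ltNge; apply/negP => a_ge0.
(* This is the real part of the equation multiplied by the conjugate of [z]. *)
have key : a * ((a ^+ 2 + b ^+ 2) * h - k) = (a ^+ 2 + b ^+ 2) * s.
  have := congr1 ( *%R a) reE; have := congr1 ( *%R b) imE; lra.
have r_ge0 : 0 <= a ^+ 2 + b ^+ 2 by rewrite addr_ge0 ?sqr_ge0.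
have r0 : a ^+ 2 + b ^+ 2 = 0.
  apply/eqP; rewrite eq_le r_ge0 andbT leNgt; apply/negP => r_gt0.
  have : (a ^+ 2 + b ^+ 2) * s < 0 by rewrite pmulr_rlt0.
  rewrite -key ltNge mulr_ge0 // subr_ge0.
  by rewrite (le_trans (ltW k_lt0)) // mulr_ge0 // ltW.
move/eqP: r0; rewrite paddr_eq0 ?sqr_ge0 // !sqrf_eq0 => /andP[/eqP a0 /eqP b0].
by move: reE k_lt0; rewrite a0 b0 !mul0r !subr0 mul0r add0r => <-; rewrite ltxx.
Qed.

(** Pairing the pencil with [conj(y)], where [v = y^T D] and [D] witnesses the
    diagonal stability of [M], makes every coefficient a form whose sign is
    known.  Diagonality of [D] is essential: it is what makes [D diag(l)]
    symmetric and negative definite. *)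
Lemma diagonally_stable_pencil (R : realType) (n : nat) (M : 'M[R]_n)
    (l : 'rV[R]_n) (v : 'rV[R[i]]_n) (z : R[i]) :
  (forall i, l 0 i < 0) -> diagonally_stable M -> v != 0 ->
  z ^+ 2 *: v = z *: (v *m complexmx M) + v *m complexmx (diag_mx l) ->
  complex.Re z < 0.
Proof.
move=> l_lt0 [d [d_gt0 [_ negQ]]] v0 eq_v.
pose D := diag_mx d; pose N := diag_mx (\row_j (d 0 j * l 0 j)).
pose y : 'cV[R[i]]_n := \col_j (v 0 j / (d 0 j)%:C%C).
have vE : v = y^T *m complexmx D.
  apply/rowP=> j; rewrite map_diag_mx mul_mx_diag !mxE divfK //.
  by rewrite fmorph_eq0 gt_eqF.
have y0 : y != 0.
  by apply: contraNneq v0 => y0; rewrite vE y0 trmx0 mul0mx.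
have ND : N = D *m diag_mx l.
  by rewrite mulmx_diag.
apply: (@quadratic_root_Re_lt0 _ z (hform y (D *m M)) (realform y D)
                               (realform y N)).
- exact: realform_gt0 (diag_form_gt0 d_gt0) y0.
- rewrite -oppr_gt0 -realformN; apply: realform_gt0 y0.
  have -> : - N = diag_mx (\row_j (d 0 j * - l 0 j)).
    by rewrite -linearN; congr diag_mx; apply/rowP=> j; rewrite !mxE mulrN.
  by apply: diag_form_gt0 => j; rewrite mxE mulr_gt0 // oppr_gt0.
- rewrite hformE /=.
  (* A real quadratic form does not distinguish [D *m M] from its transpose,
     so its value there is half of its value at their sum. *)
  suff : 0 < realform y (- (D *m M + M^T *m D)).
    rewrite realformN realformD -[M^T *m D]trmxK realform_tr trmx_mul trmxK.
    by rewrite tr_diag_mx; lra.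
  apply: realform_gt0 y0 => x x0.
  by rewrite mulmxN mulNmx mxE oppr_gt0 negQ.
have := congr1 (fun w : 'rV_n => (w *m map_mx (@conjc R) y) 0 0) eq_v.
rewrite -!hform_sym ?tr_diag_mx // /hform ND !map_mxM vE.
by rewrite !mulmxA mulmxDl -!scalemxAl !mxE.
Qed.

Theorem theorem6 (R : realType) (n : nat) (A B : 'M[R]_n) :
  (forall (S : 'M[R[i]]_n) (nu : 'rV[R[i]]_n) (M : 'M[R]_n),
      S \in unitmx ->
      complexmx B = S *m diag_mx nu *m invmx S ->
      (forall i, nu 0 i < 0) ->
      complexmx M = invmx S *m complexmx A *m S ->
      diagonally_stable M ->
      stable_mx (companion2 A B))
  /\
  (negative_diagonal B -> diagonally_stable A -> stable_mx (companion2 A B)).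
Proof.
have main (S : 'M[R[i]]_n) (nu : 'rV[R[i]]_n) (M : 'M[R]_n) :
    S \in unitmx -> complexmx B = S *m diag_mx nu *m invmx S ->
    (forall i, nu 0 i < 0) -> complexmx M = invmx S *m complexmx A *m S ->
    diagonally_stable M -> stable_mx (companion2 A B).
  move=> uS BE nu_lt0 ME stM z.
  rewrite /companion2 map_block_mx map_mx1 map_mx0.
  case/companion_eigenvalue_pencil=> u u0 /(pencil_similar uS u0)[v v0].
  rewrite -ME BE -[S *m _ *m _]mulmxA mulKmx // mulmxKV //.
  (* Negativity in [R[i]] includes reality, so [nu] comes from a real vector. *)
  pose l := map_mx (@complex.Re R) nu.
  have nuE : diag_mx nu = complexmx (diag_mx l).
    rewrite map_diag_mx; congr diag_mx; apply/rowP=> j; rewrite !mxE.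
    by have := nu_lt0 j; case: (nu 0 j) => a b; rewrite ltcE /= => /andP[/eqP<-].
  rewrite nuE; apply: diagonally_stable_pencil v0 => // j; rewrite mxE.
  by have := nu_lt0 j; rewrite ltcE => /andP[].
split=> // -[/diag_mxP[d BE] B_lt0] stA.
apply: (main 1%:M (complexmx d) A) => //.
- exact: unitmx1.
- by rewrite BE map_diag_mx invmx1 mul1mx mulmx1.
- by move=> i; rewrite mxE ltcR; have := B_lt0 i; rewrite BE mxE eqxx.
- by rewrite invmx1 mul1mx mulmx1.
Qed.
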